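(* Let $A, B \in \mathbb{P}_m$ be $m\times m$ positive definite Hermitian matrices and let $t \in [0,1]$. Then $$ A \natural_t B \prec_{w\log} A \diamond_t B. $$
   Context: $\mathbb{P}_m$ is the set of $m\times m$ complex positive definite Hermitian matrices; real powers are taken by functional calculus. Write $A\# B=A^{1/2}(A^{-1/2}BA^{-1/2})^{1/2}A^{1/2}$ for the metric geometric mean. The spectral geometric mean is $A\natural_t B=(A^{-1}\# B)^t A (A^{-1}\# B)^t$. The two-variable Wasserstein mean is $A\diamond_t B=(1-t)^2A+t^2B+t(1-t)\left[A(A^{-1}\# B)+(A^{-1}\# B)A\right]$, which equals $\left[(1-t)I+t(A^{-1}\# B)\right]A\left[(1-t)I+t(A^{-1}\# B)\right]$. For $X,Y\in\mathbb{P}_m$ with eigenvalues listed in non-increasing order, $X\prec_{w\log}Y$ (weak log-majorization) means $\prod_{i=1}^k\lambda_i(X)\le\prod_{i=1}^k\lambda_i(Y)$ for all $k=1,\dots,m$. *)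

(* Defs.v *)
From mathcomp Require Import all_boot all_order all_algebra.
From mathcomp Require Import complex.
From mathcomp Require Import reals exp.

Set Implicit Arguments.
Unset Strict Implicit.
Unset Printing Implicit Defensive.

Import Order.TTheory GRing.Theory Num.Theory.
Local Open Scope ring_scope.
Local Open Scope complex_scope.
Local Open Scope sesquilinear_scope.

(* The order on R[i] is partial: 0 < z means that z is real and positive. *)
Definition posdefmx (R : realType) (m : nat) (A : 'M[R[i]]_m) : Prop :=
  A \is hermsymmx /\
  forall v : 'cV[R[i]]_m, v != 0 -> 0 < (v ^t* *m A *m v) 0 0.

(* Functional calculus in the spectral decomposition
   A = (spectralmx A)^-1 * diag_mx (spectral_diag A) * spectralmx A,
   which holds when A is Hermitian; the eigenvalues are then real. *)
Definition mxfun (R : realType) (m : nat) (f : R -> R) (A : 'M[R[i]]_m) :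
    'M[R[i]]_m :=
  invmx (spectralmx A) *m
  diag_mx (map_mx (fun z : R[i] => (f (complex.Re z))%:C) (spectral_diag A)) *m
  spectralmx A.

Definition mxpowR (R : realType) (m : nat) (A : 'M[R[i]]_m) (s : R) :
    'M[R[i]]_m :=
  mxfun (fun x => x `^ s) A.

(* A # B *)
Definition geomean (R : realType) (m : nat) (A B : 'M[R[i]]_m) : 'M[R[i]]_m :=
  let Ah := mxpowR A 2^-1 in
  let Anh := mxpowR A (- 2^-1) in
  Ah *m mxpowR (Anh *m B *m Anh) 2^-1 *m Ah.

Definition spectral_geomean (R : realType) (m : nat) (t : R)
    (A B : 'M[R[i]]_m) : 'M[R[i]]_m :=
  let Gt := mxpowR (geomean (invmx A) B) t in Gt *m A *m Gt.

Definition wasserstein_mean (R : realType) (m : nat) (t : R)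
    (A B : 'M[R[i]]_m) : 'M[R[i]]_m :=
  let G := geomean (invmx A) B in
  ((1 - t) ^+ 2)%:C *: A + (t ^+ 2)%:C *: B +
  (t * (1 - t))%:C *: (A *m G + G *m A).

(* The roots of the characteristic polynomial, with multiplicity, in
   non-increasing order; they are real when X is Hermitian.  The sequence is
   indexed from 0, so its entry i is lambda_(i+1)(X). *)
Definition eigenvalues (R : realType) (m : nat) (X : 'M[R[i]]_m) : seq R :=
  sort >=%R
    [seq complex.Re z | z <- sval (closed_field_poly_normal (char_poly X))].

Definition weak_log_majorized (R : realType) (m : nat) (X Y : 'M[R[i]]_m) :
    Prop :=
  forall k : nat, (1 <= k <= m)%N ->
    \prod_(i < k) (eigenvalues X)`_i <= \prod_(i < k) (eigenvalues Y)`_i.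

(* Main.v *)
Require Import Defs.
From mathcomp Require Import all_boot all_order all_algebra.
From mathcomp Require Import complex.
From mathcomp Require Import reals exp ring.

Set Implicit Arguments.
Unset Strict Implicit.
Unset Printing Implicit Defensive.

Import Order.TTheory GRing.Theory Num.Theory.
Local Open Scope ring_scope.
Local Open Scope complex_scope.
Local Open Scope sesquilinear_scope.

(* Put G = A^-1 # B, so that G A G = B, and W = (1 - t) I + t G; the Wasserstein
   mean is W A W.  The matrix K = G^t W^-1 is a function of G, hence Hermitian,
   and K <= I by the weighted AM-GM inequality x^t <= 1 - t + t x.  Since
   G^t A G^t = K (W A W) K, compression by the contraction K decreases every
   eigenvalue, which is more than weak log-majorization. *)

(** * Conjugate transposes and similarity *)

Lemma hermsymmxP (C : numClosedFieldType) n (A : 'M[C]_n) :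
  A \is hermsymmx <-> A ^t* = A.
Proof.
split=> [/is_hermitianmxP|hA]; first by rewrite expr0 scale1r.
by apply/is_hermitianmxP; rewrite expr0 scale1r hA.
Qed.

Lemma trmxC_mul (C : numClosedFieldType) m n p (A : 'M[C]_(m, n))
  (B : 'M[C]_(n, p)) : (A *m B) ^t* = B ^t* *m A ^t*.
Proof. by rewrite trmx_mul map_mxM. Qed.

Lemma char_poly_conj (F : fieldType) n (P A : 'M[F]_n) : P \in unitmx ->
  char_poly (invmx P *m A *m P) = char_poly A.
Proof.
move=> uP; rewrite /char_poly.
have VP : map_mx polyC (invmx P) *m map_mx polyC P = 1%:M.
  by rewrite -map_mxM mulVmx // map_mx1.
have -> : char_poly_mx (invmx P *m A *m P) =
    map_mx polyC (invmx P) *m char_poly_mx A *m map_mx polyC P.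
  rewrite /char_poly_mx mulmxBr mulmxBl !map_mxM/= scalar_mxC.
  by rewrite -[_%:M *m _ *m _]mulmxA VP mulmx1.
by rewrite !det_mulmx mulrAC -det_mulmx VP det1 mul1r.
Qed.

(** * Unitary diagonalization and quadratic forms on eigenspaces *)

Section Spectral.
Context {C : numClosedFieldType} {n : nat}.
Implicit Types (A : 'M[C]_n) (u : 'rV[C]_n).

Lemma mulmx_spectralC A : spectralmx A *m (spectralmx A) ^t* = 1%:M.
Proof. exact/unitarymxP/spectral_unitarymx. Qed.

Lemma mulmxC_spectral A : (spectralmx A) ^t* *m spectralmx A = 1%:M.
Proof. exact: mulmx1C (mulmx_spectralC A). Qed.

Lemma hermsymmx_spectral A : A \is hermsymmx ->
  A = (spectralmx A) ^t* *m diag_mx (spectral_diag A) *m spectralmx A.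
Proof.
move=> /hermitian_normalmx/orthomx_spectralP{1}->.
by rewrite invmx_unitary // spectral_unitarymx.
Qed.

Lemma diag_form (d : 'rV[C]_n) u :
  (u *m diag_mx d *m u ^t*) 0 0 = \sum_i d 0 i * `|u 0 i| ^+ 2.
Proof.
rewrite mxE; apply: eq_bigr => i _.
by rewrite mul_mx_diag !mxE -mulrA mulrCA -normCK.
Qed.

Lemma dot_form u : (u *m u ^t*) 0 0 = \sum_i `|u 0 i| ^+ 2.
Proof. by rewrite mxE; apply: eq_bigr => i _; rewrite !mxE -normCK. Qed.

Lemma spectral_form A u : A \is hermsymmx -> (u *m A *m u ^t*) 0 0 =
  \sum_i spectral_diag A 0 i * `|(u *m (spectralmx A) ^t*) 0 i| ^+ 2.
Proof.
move=> /hermsymmx_spectral{1}->.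
by rewrite -diag_form !trmxC_mul trmxCK !mulmxA.
Qed.

Lemma spectral_dot A u :
  (u *m u ^t*) 0 0 = \sum_i `|(u *m (spectralmx A) ^t*) 0 i| ^+ 2.
Proof.
rewrite -dot_form trmxC_mul trmxCK -!mulmxA (mulmxA _ (spectralmx A)).
by rewrite mulmxC_spectral mul1mx.
Qed.

Lemma dot_eq0 u : ((u *m u ^t*) 0 0 == 0) = (u == 0).
Proof.
rewrite dot_form psumr_eq0 => [|i _]; last by rewrite exprn_ge0.
apply/allP/eqP => [h|-> i _]; last by rewrite mxE normr0 expr0n /= eqxx.
apply/rowP => i; rewrite mxE; apply/eqP.
by have := h i (mem_index_enum i); rewrite sqrf_eq0 normr_eq0.
Qed.

(** Diagonalization is a similarity, so the characteristic polynomial splits over the diagonal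
    entries; unique factorization then fixes the roots up to order. *)
Lemma perm_char_poly_roots A : A \is hermsymmx ->
  perm_eq (sval (closed_field_poly_normal (char_poly A)))
    [seq spectral_diag A 0 i | i <- enum 'I_n].
Proof.
move=> hA; apply: prod_XsubC_eq.
case: closed_field_poly_normal => s /= ps.
move: (ps); rewrite (monicP (char_poly_monic A)) scale1r => <-.
rewrite {1}(orthomx_spectralP (hermitian_normalmx hA)).
rewrite char_poly_conj ?spectral_unit // char_poly_trig; last first.
  exact/diag_mx_is_trig.
rewrite big_map big_enum; apply: eq_bigr => i _.
by rewrite mxE eqxx mulr1n.
Qed.

(** For Hermitian [A] the rows of [spectralmx A] are orthonormal left eigenvectors, so the row space
    of this matrix is the sum of the eigenlines indexed by [I]. *)
Definition spectral_rows (I : {pred 'I_n}) A : 'M[C]_(#|I|, n) :=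
  rowsub (fun k => enum_val k) (spectralmx A).

Lemma mxrank_spectral_rows (I : {pred 'I_n}) A :
  \rank (spectral_rows I A) = #|I|.
Proof.
apply: mxrank_unitary; apply/unitarymxP.
apply/matrixP => i j.
have /matrixP/(_ (enum_val i) (enum_val j)) := mulmx_spectralC A.
rewrite !mxE (inj_eq enum_val_inj) => <-.
by apply: eq_bigr => k _; rewrite !mxE.
Qed.

(** The entries of [u *m (spectralmx A) ^t*] are the coordinates of [u] in the orthonormal
    eigenbasis, and [u] only involves basis vectors from [I]. *)
Lemma spectral_rows_coord (I : {pred 'I_n}) A u j :
  (u <= spectral_rows I A)%MS -> j \notin I ->
  (u *m (spectralmx A) ^t*) 0 j = 0.
Proof.
move=> /submxP[a ->] jI.
rewrite -mulmxA mul_rowsub_mx mulmx_spectralC mxE big1 // => k _.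
rewrite !mxE; case: eqP => [e|]; last by rewrite mulr0.
by rewrite -e enum_valP in jI.
Qed.

Lemma spectral_rows_ge (c : C) A u : A \is hermsymmx ->
  (u <= spectral_rows [pred i | (c <= spectral_diag A 0 i)%R] A)%MS ->
  c * (u *m u ^t*) 0 0 <= (u *m A *m u ^t*) 0 0.
Proof.
move=> hA uU; rewrite spectral_form // (spectral_dot A) mulr_sumr.
apply: ler_sum => i _.
have [ci|/negbTE ci] := boolP (c <= spectral_diag A 0 i).
  by rewrite ler_wpM2r // exprn_ge0.
by rewrite (spectral_rows_coord uU) ?inE ?ci // normr0 expr0n !mulr0.
Qed.

(** Strict because equality would force every nonnegative term (c - d_i)|u_i|^2 to vanish, and with
    it every coordinate of the nonzero [u]. *)
Lemma spectral_rows_lt (c : C) A u : A \is hermsymmx -> u != 0 ->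
  (u <= spectral_rows [pred i | (spectral_diag A 0 i < c)%R] A)%MS ->
  (u *m A *m u ^t*) 0 0 < c * (u *m u ^t*) 0 0.
Proof.
move=> hA u0 uU; rewrite spectral_form // (spectral_dot A) mulr_sumr.
have H i : spectral_diag A 0 i * `|(u *m (spectralmx A)^t*) 0 i| ^+ 2 <=
   c * `|(u *m (spectralmx A)^t*) 0 i| ^+ 2.
  have [ci|ci] := boolP (spectral_diag A 0 i < c).
    by rewrite ler_wpM2r ?exprn_ge0 // ltW.
  by rewrite (spectral_rows_coord uU) ?inE ?ci // normr0 expr0n !mulr0.
rewrite lt_neqAle ler_sum ?andbT // -subr_eq0 -sumrB; apply/negP => h.
have {}h : \sum_i (c - spectral_diag A 0 i) *
    `|(u *m (spectralmx A)^t*) 0 i| ^+ 2 == 0.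
  rewrite -oppr_eq0 -sumrN; apply: etrans h; congr (_ == _).
  by apply: eq_bigr => i _; rewrite mulrBl opprB.
move: h; rewrite psumr_eq0 => [|i _]; last by rewrite mulrBl subr_ge0.
move=> /allP h; move: u0.
rewrite -dot_eq0 (spectral_dot A) big1 ?eqxx // => i _.
have [ci|ci] := boolP (spectral_diag A 0 i < c).
  have := h i (mem_index_enum i); rewrite mulf_eq0 subr_eq0 gt_eqF //=.
  by move/eqP.
by rewrite (spectral_rows_coord uU) ?inE ?ci // normr0 expr0n.
Qed.

(* The rows spanning the eigenspaces of K A K above c are moved by K into the
   region where the form of A is at least c, so they avoid the eigenspaces of A
   below c. *)
Lemma leq_card_spectral_compress (c : C) (K A : 'M[C]_n) :
  0 <= c -> A \is hermsymmx -> K \is hermsymmx -> K \in unitmx ->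
  (forall u, (u *m K *m (u *m K) ^t*) 0 0 <= (u *m u ^t*) 0 0) ->
  (#|[pred i | (c <= spectral_diag (K *m A *m K) 0 i)%R]| +
   #|[pred i | (spectral_diag A 0 i < c)%R]| <= n)%N.
Proof.
move=> c0 hA /hermsymmxP hK uK K1.
have hX : K *m A *m K \is hermsymmx.
  by apply/hermsymmxP; rewrite !trmxC_mul hK (hermsymmxP A).1 // mulmxA.
set I := [pred i | _]; set J := [pred i | _].
(* Both cardinals become ranks, and the invertible [K] preserves the first one; subspaces meeting
   only in 0 have ranks adding up to at most n. *)
rewrite -(mxrank_spectral_rows I (K *m A *m K)) -(mxrank_spectral_rows J A).
rewrite -(mxrankMfree _ (B := K)) ?row_free_unit //.
rewrite -mxrank_disjoint_sum ?rank_leq_row //; last first.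
  apply/eqP/rowV0P => v; rewrite sub_capmx => /andP[/submxP[a va] vJ].
  apply: contraTeq isT => v0.
  pose u := a *m spectral_rows I (K *m A *m K).
  have vE : v = u *m K by rewrite va mulmxA.
  have h1 := spectral_rows_lt hA v0 vJ.
  have h2 := spectral_rows_ge hX (submxMl a _ : (u <= _)%MS).
  (* With v = uK, the form of [A] at v is < c|v|^2 <= c|u|^2 <= the form of KAK at u, which is again
     the form of [A] at v: a contradiction. *)
  have := lt_le_trans h1 (ler_wpM2l c0 (_ : _ <= (u *m u ^t*) 0 0)).
  rewrite {1 2}vE => /(_ (K1 u)) /lt_le_trans/(_ h2).
  by rewrite vE trmxC_mul hK !mulmxA ltxx.
Qed.

End Spectral.

(** Used with a = 1 - t and b = t, where GAG stands for B, to write the Wasserstein sum as a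
    congruence of A. *)
Lemma mulmx_affine_congr (R : comNzRingType) n (a b : R) (A G : 'M[R]_n) :
  a ^+ 2 *: A + b ^+ 2 *: (G *m A *m G) + (b * a) *: (A *m G + G *m A) =
  (a%:M + b *: G) *m A *m (a%:M + b *: G).
Proof.
rewrite mulmxDr mul_mx_scalar mulmxDl mul_scalar_mx -!scalemxAl -scalemxAr.
rewrite mulmxDl -!scalemxAl !scalerDr !scalerA -!expr2 (mulrC a) -!addrA.
by congr (_ + _); rewrite [LHS]addrC [X in X + _]addrC -addrA.
Qed.

(** * Positive definite matrices and their functional calculus *)

Section PositiveDefinite.
Context {C : numClosedFieldType} {n : nat}.
Implicit Types (A B P : 'M[C]_n) (f g : C -> C).

(** Counterpart of [posdefmx] over any numerically closed field; the two are convertible over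
    [R[i]]. *)
Definition pdmx A : Prop :=
  A \is hermsymmx /\ forall v : 'cV[C]_n, v != 0 -> 0 < (v ^t* *m A *m v) 0 0.

Definition spectral_fun f A : 'M[C]_n :=
  invmx (spectralmx A) *m diag_mx (map_mx f (spectral_diag A)) *m spectralmx A.

Lemma pdmx_trmxC A : pdmx A -> A ^t* = A.
Proof. by case=> /hermsymmxP. Qed.

Lemma pdmx_diag P (d : 'rV[C]_n) : P \is unitarymx ->
  (forall i, 0 < d 0 i) -> pdmx (P ^t* *m diag_mx d *m P).
Proof.
move=> uP d0; have dC : (diag_mx d) ^t* = diag_mx d.
  rewrite tr_diag_mx map_diag_mx; congr diag_mx; apply/rowP => i.
  by rewrite mxE; apply/CrealP/ger0_real/ltW.
split.
  by apply/hermsymmxP; rewrite !trmxC_mul trmxCK dC mulmxA.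
move=> v v0; pose u := (P *m v) ^t*.
have -> : (v ^t* *m (P ^t* *m diag_mx d *m P) *m v) 0 0 =
    (u *m diag_mx d *m u ^t*) 0 0.
  by rewrite /u trmxCK trmxC_mul !mulmxA.
have u0 : u != 0.
  apply: contraNneq v0 => u0; have /(congr1 (fun M => M ^t*)) := u0.
  rewrite /u trmxCK trmx0 map_mx0 => Pv0.
  by rewrite -(mulKmx (unitarymx_unit uP) v) Pv0 mulmx0.
have h i : 0 <= d 0 i * `|u 0 i| ^+ 2 by rewrite mulr_ge0 ?exprn_ge0 // ltW.
rewrite diag_form lt_neqAle sumr_ge0 // andbT eq_sym psumr_eq0 //.
apply: contra u0 => /allP u0; apply/eqP/rowP => i; rewrite [RHS]mxE; apply/eqP.
have := u0 i (mem_index_enum i).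
by rewrite mulf_eq0 gt_eqF //= sqrf_eq0 normr_eq0.
Qed.

(** The quadratic form evaluated at the i-th unit eigenvector is the i-th eigenvalue. *)
Lemma pdmx_spectral_gt0 A i : pdmx A -> 0 < spectral_diag A 0 i.
Proof.
move=> [hA pA]; pose u : 'rV_n := delta_mx 0 i *m spectralmx A.
have uP : u *m (spectralmx A) ^t* = delta_mx 0 i.
  by rewrite /u -mulmxA mulmx_spectralC mulmx1.
have u0 : u ^t* != 0.
  apply/eqP => /(congr1 (fun M => M ^t*)); rewrite trmxCK trmx0 map_mx0.
  move=> u0; have /rowP/(_ i)/eqP := uP.
  by rewrite u0 mul0mx !mxE !eqxx eq_sym oner_eq0.
have := pA _ u0.
rewrite trmxCK spectral_form // uP (bigD1 i) //= big1 => [|j ji].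
  by rewrite mxE !eqxx normr1 expr1n mulr1 addr0.
by rewrite mxE eqxx (negbTE ji) normr0 expr0n mulr0.
Qed.

Lemma spectral_funE f A : spectral_fun f A =
  (spectralmx A) ^t* *m diag_mx (map_mx f (spectral_diag A)) *m spectralmx A.
Proof. by rewrite /spectral_fun invmx_unitary ?spectral_unitarymx. Qed.

(** Identities for inverses and powers are only available at positive arguments; this suffices
    because the spectrum of [A] is positive. *)
Lemma eq_spectral_fun f g A : pdmx A -> (forall x, 0 < x -> f x = g x) ->
  spectral_fun f A = spectral_fun g A.
Proof.
move=> pA fg; rewrite /spectral_fun.
suff -> : map_mx f (spectral_diag A) = map_mx g (spectral_diag A) by [].
by apply/rowP => i; rewrite !mxE fg // pdmx_spectral_gt0.
Qed.

Lemma spectral_funM f g A :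
  spectral_fun f A *m spectral_fun g A = spectral_fun (fun x => f x * g x) A.
Proof.
rewrite !spectral_funE -mulmxA 2!(mulmxA (spectralmx A)) mulmx_spectralC mul1mx.
rewrite !mulmxA -[_ *m diag_mx _ *m diag_mx _]mulmxA mulmx_diag.
by congr (_ *m diag_mx _ *m _); apply/rowP => i; rewrite !mxE.
Qed.

Lemma spectral_fun_id A : A \is hermsymmx -> spectral_fun id A = A.
Proof.
move=> hA; rewrite [RHS](hermsymmx_spectral hA) spectral_funE.
by congr (_ *m diag_mx _ *m _); apply/rowP => i; rewrite mxE.
Qed.

Lemma spectral_fun_cst a A : spectral_fun (fun=> a) A = a%:M.
Proof.
rewrite spectral_funE (_ : map_mx (fun=> a) _ = const_mx a).
  rewrite diag_const_mx mul_mx_scalar -scalemxAl mulmxC_spectral.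
  by rewrite scale_scalar_mx mulr1.
by apply/matrixP => i j; rewrite !mxE.
Qed.

Lemma spectral_funD f g A :
  spectral_fun (fun x => f x + g x) A = spectral_fun f A + spectral_fun g A.
Proof.
rewrite /spectral_fun -mulmxDl -mulmxDr -linearD /=.
by congr (_ *m diag_mx _ *m _); apply/rowP => i; rewrite !mxE.
Qed.

Lemma spectral_funZ a f A :
  spectral_fun (fun x => a * f x) A = a *: spectral_fun f A.
Proof.
rewrite /spectral_fun scalemxAl scalemxAr -linearZ /=.
by congr (_ *m diag_mx _ *m _); apply/rowP => i; rewrite !mxE.
Qed.

Lemma pdmx_spectral_fun f A : pdmx A -> (forall x, 0 < x -> 0 < f x) ->
  pdmx (spectral_fun f A).
Proof.
move=> pA f0; rewrite spectral_funE; apply: pdmx_diag => [|i].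
  exact: spectral_unitarymx.
by rewrite mxE f0 // pdmx_spectral_gt0.
Qed.

(** In the eigenbasis of [A] each coordinate of [u] is multiplied by a factor in [0, 1]. *)
Lemma spectral_fun_contract f A : pdmx A ->
  (forall x, 0 < x -> 0 <= f x <= 1) -> forall u : 'rV_n,
  (u *m spectral_fun f A *m (u *m spectral_fun f A) ^t*) 0 0 <=
  (u *m u ^t*) 0 0.
Proof.
move=> pA f01 u; rewrite !(spectral_dot A); apply: ler_sum => i _.
rewrite spectral_funE !mulmxA -(mulmxA _ (spectralmx A)) mulmx_spectralC mulmx1.
rewrite mul_mx_diag !mxE normrM exprMn ler_piMr ?exprn_ge0 //.
have /andP[f0 f1] := f01 _ (pdmx_spectral_gt0 i pA).
by rewrite exprn_ile1 // ger0_norm.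
Qed.

Lemma mulmx_spectral_funV A : pdmx A ->
  A *m spectral_fun (fun x => x^-1) A = 1%:M.
Proof.
move=> pA; have [hA _] := pA.
rewrite -{1}(spectral_fun_id hA) spectral_funM -[RHS](spectral_fun_cst 1 A).
by apply: eq_spectral_fun => // x x0; rewrite divff // gt_eqF.
Qed.

Lemma pdmx_unit A : pdmx A -> A \in unitmx.
Proof. by move=> /mulmx_spectral_funV/mulmx1_unit[]. Qed.

Lemma pdmx_congr A P : pdmx A -> pdmx P -> pdmx (P *m A *m P).
Proof.
move=> [/hermsymmxP hA pA] pP; have hP := pdmx_trmxC pP; split.
  by apply/hermsymmxP; rewrite !trmxC_mul hP hA mulmxA.
move=> v v0; have := pA (P *m v); rewrite trmxC_mul hP !mulmxA; apply.
by apply: contraNneq v0 => Pv; rewrite -(mulKmx (pdmx_unit pP) v) Pv mulmx0.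
Qed.

Lemma pdmx_inv A : pdmx A -> pdmx (invmx A).
Proof.
move=> pA; have -> : invmx A = spectral_fun (fun x => x^-1) A.
  by rewrite -[RHS](mulKmx (pdmx_unit pA)) mulmx_spectral_funV // mulmx1.
by apply: pdmx_spectral_fun => // x; rewrite invr_gt0.
Qed.

(* [sq] and [isq] stand for the functions x^(1/2) and x^(-1/2). *)
Definition geomean_of (sq isq : C -> C) A B : 'M[C]_n :=
  spectral_fun sq A *m
  spectral_fun sq (spectral_fun isq A *m B *m spectral_fun isq A) *m
  spectral_fun sq A.

(** * The Riccati equation and the factorization of the Wasserstein mean *)

Section Geomean.
Variables sq isq : C -> C.
Hypothesis sq_gt0 : forall x, 0 < x -> 0 < sq x.
Hypothesis isq_gt0 : forall x, 0 < x -> 0 < isq x.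
Hypothesis sq_sqr : forall x, 0 < x -> sq x * sq x = x.
Hypothesis isqK : forall x, 0 < x -> isq x * sq x = 1.

Lemma sq_spectral_fun A : pdmx A -> spectral_fun sq A *m spectral_fun sq A = A.
Proof.
move=> pA; have [hA _] := pA.
by rewrite spectral_funM -[RHS](spectral_fun_id hA); apply: eq_spectral_fun.
Qed.

Lemma pdmx_geomean A B : pdmx A -> pdmx B -> pdmx (geomean_of sq isq A B).
Proof.
move=> pA pB; apply: pdmx_congr; last exact: pdmx_spectral_fun.
apply: pdmx_spectral_fun => //; apply: pdmx_congr => //.
exact: pdmx_spectral_fun.
Qed.

(** Write A # B = HSH with H = A^(1/2), N = H^-1 and S^2 = NBN. Since H A^-1 H = I, the product
    collapses to H S^2 H = HNBNH = B. *)
Lemma geomean_riccati A B : pdmx A -> pdmx B ->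
  geomean_of sq isq A B *m invmx A *m geomean_of sq isq A B = B.
Proof.
move=> pA pB; rewrite /geomean_of.
have SS := sq_spectral_fun (pdmx_congr pB (pdmx_spectral_fun pA isq_gt0)).
have HH := sq_spectral_fun pA.
have NH : spectral_fun isq A *m spectral_fun sq A = 1%:M.
  by rewrite spectral_funM -(spectral_fun_cst 1 A); apply: eq_spectral_fun.
(* From here only the relations HH = A, NH = I and SS = NBN matter. *)
move: (spectral_fun sq A) (spectral_fun isq A) HH NH SS => H N HH NH.
move: (spectral_fun sq _) => S SS.
have HN : H *m N = 1%:M by apply: mulmx1C.
have HAH : H *m invmx A *m H = 1%:M.
  have uH : H \in unitmx by have [] := mulmx1_unit HN.
  rewrite -HH (_ : invmx (H *m H) = invmx H *m invmx H).
    by rewrite mulmxA mulmxV // mul1mx mulVmx.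
  apply: (can_inj (mulKmx (_ : H *m H \in unitmx))); rewrite ?unitmx_mul ?uH //.
  rewrite mulmxV ?unitmx_mul ?uH // -mulmxA (mulmxA H (invmx H)) mulmxV //.
  by rewrite mul1mx mulmxV.
transitivity (H *m (S *m (H *m invmx A *m H) *m S) *m H).
  by rewrite !mulmxA.
by rewrite HAH mulmx1 SS !mulmxA HN mul1mx -mulmxA NH mulmx1.
Qed.

(** The Riccati equation for A^-1 gives GAG = B. [W] is stated as a function of [G] so that it
    commutes with the other functions of [G]. *)
Lemma wasserstein_factor (t : C) A B : pdmx A -> pdmx B ->
  let G := geomean_of sq isq (invmx A) B in
  let W := spectral_fun (fun x => 1 - t + t * x) G in
  (1 - t) ^+ 2 *: A + t ^+ 2 *: B + (t * (1 - t)) *: (A *m G + G *m A) =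
  W *m A *m W.
Proof.
move=> pA pB G W; have [hG _] := pdmx_geomean (pdmx_inv pA) pB.
have := geomean_riccati (pdmx_inv pA) pB; rewrite invmxK -/G => <-.
have -> : W = (1 - t)%:M + t *: G.
  rewrite /W (spectral_funD (fun=> 1 - t) (fun x => t * x)) spectral_fun_cst.
  by rewrite (spectral_funZ t id) spectral_fun_id.
exact: mulmx_affine_congr.
Qed.

(** Here [pw] stands for x^t and its bound for weighted AM-GM. The order on [C] is partial, so the
    eigenvalues of [Y] below c are counted, and complements are taken later, over real spectra. *)
Lemma leq_card_spectral_wasserstein (t : C) (pw : C -> C) A B :
  pdmx A -> pdmx B ->
  (forall x, 0 < x -> 0 < pw x <= 1 - t + t * x) ->
  let G := geomean_of sq isq (invmx A) B in
  let X := spectral_fun pw G *m A *m spectral_fun pw G in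
  let Y := (1 - t) ^+ 2 *: A + t ^+ 2 *: B +
           (t * (1 - t)) *: (A *m G + G *m A) in
  [/\ pdmx X, Y \is hermsymmx & forall c : C, 0 <= c ->
    (#|[pred i | (c <= spectral_diag X 0 i)%R]| +
     #|[pred i | (spectral_diag Y 0 i < c)%R]| <= n)%N].
Proof.
move=> pA pB pw_le G; rewrite wasserstein_factor // -/G => X Y.
have pG : pdmx G by apply: pdmx_geomean => //; apply: pdmx_inv.
have pw_gt0 x : 0 < x -> 0 < pw x by move=> /pw_le/andP[].
have w_gt0 x : 0 < x -> 0 < 1 - t + t * x.
  by move=> /pw_le/andP[+ ?] => /lt_le_trans; apply.
pose K := spectral_fun (fun x => pw x / (1 - t + t * x)) G.
pose W := spectral_fun (fun x => 1 - t + t * x) G; pose Gt := spectral_fun pw G.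
have pK : pdmx K.
  by apply: pdmx_spectral_fun => // x x0; rewrite divr_gt0 ?pw_gt0 ?w_gt0.
have pW : pdmx W by apply: pdmx_spectral_fun.
have pGt : pdmx Gt by apply: pdmx_spectral_fun.
have KW : K *m W = Gt.
  rewrite spectral_funM; apply: eq_spectral_fun => // x x0.
  by rewrite /= divfK // gt_eqF // w_gt0.
have WK : W *m K = Gt.
  rewrite spectral_funM; apply: eq_spectral_fun => // x x0.
  by rewrite /= mulrC divfK // gt_eqF // w_gt0.
have [hY _] : pdmx Y by apply: pdmx_congr.
split=> // [|c c0].
  exact: pdmx_congr.
(* Of the two factors G^t, the left one is written KW and the right one WK, leaving WAW = [Y] in the
   middle. *)
have -> : X = K *m Y *m K.
  by rewrite /X /Y -/Gt -/W -{1}KW -WK !mulmxA.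
apply: leq_card_spectral_compress => //; first by case: pK.
  exact: pdmx_unit.
apply: spectral_fun_contract => // x x0; have /andP[p0 pw1] := pw_le x x0.
rewrite (divr_ge0 (ltW p0) (ltW (w_gt0 _ x0))) /=.
by rewrite ler_pdivrMr ?w_gt0 // mul1r.
Qed.

End Geomean.

End PositiveDefinite.

(** * Entrywise comparison of sorted spectra by counting *)

(** Take the threshold c = s1_i: at least i + 1 entries of [s1] reach it, whereas s2_i < s1_i would
    leave at most i such entries in [s2]. *)
Lemma sorted_count_nth (R : realDomainType) (s1 s2 : seq R) :
  sorted >=%R s1 -> sorted >=%R s2 -> size s1 = size s2 ->
  {in s1, forall x, 0 < x} ->
  (forall c : R, 0 < c -> (count (>= c) s1 <= count (>= c) s2)%N) ->
  forall i, s1`_i <= s2`_i.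
Proof.
move=> so1 so2 s12 s1_gt0 cnt i.
(* Past the common length both entries are the default 0. *)
have [i1|i1] := ltnP i (size s1); last by rewrite !nth_default -?s12.
have ge_tr : transitive (>=%R : rel R) by move=> a b c ab /le_trans; apply.
have := cnt _ (s1_gt0 _ (mem_nth 0 i1)).
rewrite leNgt; apply: contraTN => lt21; rewrite -ltnNge.
apply: (@leq_ltn_trans i).
  rewrite -[s2](cat_take_drop i) count_cat.
  have -> : count (>= s1`_i) (drop i s2) = 0%N.
    apply/eqP; rewrite -leqn0 leqNgt -has_count; apply/hasPn => x.
    move=> /(nthP 0)[j]; rewrite size_drop nth_drop ltn_subRL => jlt <-.
    rewrite -ltNge; apply: le_lt_trans lt21.
    apply: (sorted_leq_nth ge_tr (@lexx _ _) 0 so2); rewrite ?inE ?leq_addr //.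
    by rewrite -s12.
  rewrite addn0 (leq_trans (count_size _ _)) // size_take -s12 i1 //.
rewrite -[s1 in count _ s1](cat_take_drop i.+1) count_cat.
apply: (@leq_trans (size (take i.+1 s1))); first by rewrite size_takel.
have /eqP <- : count (>= s1`_i) (take i.+1 s1) == size (take i.+1 s1).
  rewrite -all_count; apply/allP => x /(nthP 0)[j].
  rewrite size_takel // ltnS => ji <-; rewrite nth_take //.
  apply: (sorted_leq_nth ge_tr (@lexx _ _) 0 so1); rewrite ?inE //.
  exact: leq_ltn_trans i1.
exact: leq_addr.
Qed.

Section Eigenvalues.
Context {R : realType} {m : nat}.
Implicit Types A X Y : 'M[R[i]]_m.

Lemma perm_eigenvalues A : A \is hermsymmx ->
  perm_eq (eigenvalues A)
    [seq complex.Re (spectral_diag A 0 i) | i <- enum 'I_m].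
Proof.
move=> hA; rewrite /eigenvalues perm_sort.
by rewrite (perm_trans (perm_map _ (perm_char_poly_roots hA))) // -map_comp.
Qed.

Lemma sorted_eigenvalues A : sorted >=%R (eigenvalues A).
Proof. by apply: sort_sorted => x y; apply: le_total. Qed.

Lemma size_eigenvalues A : A \is hermsymmx -> size (eigenvalues A) = m.
Proof.
by move=> /perm_eigenvalues/perm_size->; rewrite size_map size_enum_ord.
Qed.

Lemma Re_spectral_diag A i : A \is hermsymmx ->
  (complex.Re (spectral_diag A 0 i))%:C = spectral_diag A 0 i.
Proof. by move=> /hermitian_spectral_diag_real/mxOverP h; rewrite RRe_real. Qed.

Lemma count_eigenvalues A (c : R) : A \is hermsymmx ->
  count (>= c) (eigenvalues A) =
  #|[pred i | (c%:C <= spectral_diag A 0 i)%R]|.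
Proof.
move=> hA; rewrite (permP (perm_eigenvalues hA)) count_map -size_filter.
rewrite -(eq_card (A := [pred i | c <= complex.Re (spectral_diag A 0 i)])).
  by rewrite cardE enumT /enum_mem; congr size; apply: eq_filter => i.
by move=> i; rewrite !inE -(Re_spectral_diag i hA) lecR.
Qed.

Lemma eigenvalues_gt0 A : posdefmx A -> {in eigenvalues A, forall x, 0 < x}.
Proof.
move=> [hA pA] x; rewrite (perm_mem (perm_eigenvalues hA)) => /mapP[i _ ->].
rewrite -ltcR (Re_spectral_diag i hA).
exact: pdmx_spectral_gt0.
Qed.

Lemma ler_eigenvalues X Y : posdefmx X -> Y \is hermsymmx ->
  (forall c : R[i], 0 <= c ->
    (#|[pred i | (c <= spectral_diag X 0 i)%R]| +
     #|[pred i | (spectral_diag Y 0 i < c)%R]| <= m)%N) ->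
  forall i, (eigenvalues X)`_i <= (eigenvalues Y)`_i.
Proof.
move=> pX hY XY; have [hX _] := pX.
apply: sorted_count_nth (eigenvalues_gt0 pX) _.
- exact: sorted_eigenvalues.
- exact: sorted_eigenvalues.
- exact: etrans (size_eigenvalues hX) (esym (size_eigenvalues hY)).
move=> c c0; apply: (leq_trans (eq_leq (count_eigenvalues c hX))).
apply: leq_trans (eq_leq (esym (count_eigenvalues c hY))).
have c0' : 0 <= c%:C :> R[i] by rewrite lecR ltW.
have := XY _ c0'; set I := [pred i | _]; set J := [pred i | _].
(* Writing m as |J| + |complement of J| bounds |I| by the size of the complement; as the eigenvalues
   of [Y] are real, that complement consists of those >= c. *)
rewrite -[X in (_ <= X)%N -> _]card_ord -(cardC J) addnC leq_add2l.
move=> /leq_trans; apply; apply: eq_leq; apply: eq_card => i.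
by rewrite !inE -(Re_spectral_diag i hY) ltcR lecR leNgt.
Qed.

End Eigenvalues.

(** * The scalar weighted AM-GM inequality and the conclusion *)

Lemma powR_amgm (R : realType) (t x : R) : 0 <= t <= 1 -> 0 < x ->
  x `^ t <= 1 - t + t * x.
Proof.
move=> /andP[t0 t1] x0.
(* Apart from t = 1, the summand 1 - t is strictly positive, hence so is the right-hand side, and
   logarithms apply. *)
have [->|tn1] := eqVneq t 1.
  by rewrite powRr1 ?(ltW x0) // subrr add0r mul1r.
have s0 : 0 < 1 - t + t * x.
  by rewrite ltr_wpDr ?mulr_ge0 ?(ltW x0) // subr_gt0 lt_neqAle tn1.
(* Convex combination of 1 + y <= expR y at y = ln (x / s) and y = ln (1 / s),
   whose right-hand side is 1. *)
set s := 1 - t + _ in s0 *.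
rewrite -ler_ln ?posrE ?powR_gt0 // ln_powR.
have h1 := expR_ge1Dx (ln x - ln s); have h2 := expR_ge1Dx (- ln s).
rewrite expRD expRN !lnK ?posrE // in h1 h2.
have : t * (1 + (ln x - ln s)) + (1 - t) * (1 - ln s) <=
    t * (x / s) + (1 - t) * s^-1.
  by rewrite lerD // ler_wpM2l // subr_ge0.
have -> : t * (x / s) + (1 - t) * s^-1 = 1.
  by rewrite mulrA -mulrDl addrC divff // gt_eqF.
(* The combined left side equals 1 + t ln x - ln s, so [h] says 0 <= ln s - t ln x. *)
rewrite -subr_ge0 => h; rewrite -subr_ge0; apply: le_trans h _.
by rewrite le_eqVlt; apply/orP; left; apply/eqP; ring.
Qed.

Theorem theorem4p4 (R : realType) (m : nat) (A B : 'M[R[i]]_m) (t : R) :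
  posdefmx A -> posdefmx B -> 0 <= t <= 1 ->
  weak_log_majorized (spectral_geomean t A B) (wasserstein_mean t A B).
Proof.
move=> pA pB t01.
(* With this function [spectral_fun (pw s)] is convertible to [mxpowR] with exponent [s], so the
   abstract results transfer to the concrete means. *)
pose pw (s : R) (z : R[i]) : R[i] := (complex.Re z `^ s)%:C.
have pos (z : R[i]) : 0 < z -> exists2 x : R, 0 < x & z = x%:C.
  case: z => x y; rewrite ltcE /= => /andP[/eqP-> x0].
  by exists x.
have pw_gt0 s (z : R[i]) : 0 < z -> 0 < pw s z.
  by move=> /pos[x x0 ->]; rewrite /pw ltcR /= powR_gt0.
have pwD s r (z : R[i]) : 0 < z -> pw s z * pw r z = pw (s + r) z.
  move=> /pos[x x0 ->]; rewrite /pw /= powRD ?rmorphM //.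
  by rewrite (gt_eqF x0) implybT.
have [|||pX hY XY] := @leq_card_spectral_wasserstein _ m (pw 2^-1) (pw (- 2^-1))
  (pw_gt0 _) (pw_gt0 _) _ _ t%:C (pw t) A B pA pB.
- move=> z z0; rewrite pwD //; case: (pos z z0) => x x0 ->.
  by rewrite /pw /= (_ : 2^-1 + 2^-1 = 1 :> R) ?powRr1 ?ltW //; field.
- move=> z z0; rewrite pwD //; case: (pos z z0) => x x0 ->.
  by rewrite /pw /= addNr powRr0.
- move=> z z0; rewrite pw_gt0 //=; case: (pos z z0) => x x0 ->.
  by rewrite /pw /= -[1]/(1%:C) -rmorphB -rmorphM -rmorphD lecR powR_amgm.
have {}pX : posdefmx (spectral_geomean t A B) := pX.
have [hX _] := pX.
have YE : wasserstein_mean t A B = let G := geomean (invmx A) B in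
    (1 - t%:C) ^+ 2 *: A + t%:C ^+ 2 *: B +
    (t%:C * (1 - t%:C)) *: (A *m G + G *m A).
  by rewrite /wasserstein_mean !rmorphXn rmorphM rmorphB rmorph1.
(* The products are compared factor by factor, the smaller factors being positive. *)
rewrite YE => k /andP[_ km]; apply: ler_prod => i _; apply/andP; split.
  apply/ltW/(eigenvalues_gt0 pX)/mem_nth.
  by rewrite (size_eigenvalues hX) (leq_trans (ltn_ord i)).
exact: (ler_eigenvalues pX hY XY).
Qed.
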